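(* Let $n\ge 2$ and let $V\subset\mathbb{R}^n$ be a finite set containing no two parallel vectors. Let $T\subset\mathbb{R}^n$ be a closed set which is $V$-closed, and let $C=\operatorname{cl}\operatorname{conv} T$ be the closure of the convex hull of $T$. If $x$ is an extreme point of $C$, then there is a vector $t\in\mathbb{R}^n$ such that $x\in t+P(V)\subset C$.
   Context: For a finite set $V\subset\mathbb{R}^n$, a set $T\subset\mathbb{R}^n$ is called $V$-closed if for every $t\in T$ and every $v\in V$, at least one of $t+v$ and $t-v$ lies in $T$. The set $P(V)$ is $P(V)=\{\sum_{v\in W} v : W\subseteq V\}$ (the set of all subset sums of $V$). A point $x$ of a convex set $C$ is an extreme point if there are no two distinct points $x_0,x_1\in C$ with $x$ in the open segment between them. *)

(* Defs.v *)
(* R^n is 'rV[R]_n for R : realType,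
   with the product (matrix) topology from mathcomp-analysis. *)
From HB Require Import structures.
From mathcomp Require Import all_boot all_order all_algebra.
From mathcomp Require Import all_classical all_reals all_analysis.
Set Implicit Arguments. Unset Strict Implicit. Unset Printing Implicit Defensive.
Import Order.TTheory GRing.Theory Num.Theory.
Import numFieldNormedType.Exports.
Local Open Scope classical_set_scope.
Local Open Scope ring_scope.

Section Defs.
Context {R : realType} {n : nat}.
Local Notation vec := 'rV[R]_n.

Definition parallel (u v : vec) : Prop :=
  exists c : R, u = c *: v \/ v = c *: u.

(* V (a duplicate-free list) contains no two (distinct) parallel vectors *)
Definition no_two_parallel (V : seq vec) : Prop :=
  forall u v, u \in V -> v \in V -> u != v -> ~ parallel u v.

Definition Vclosed (V : seq vec) (T : set vec) : Prop :=
  forall t v, T t -> v \in V -> T (t + v) \/ T (t - v).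

(* P(V): the set of all subset sums of V (V duplicate-free) *)
Definition subset_sums (V : seq vec) : set vec :=
  [set x | exists S : pred vec, x = \sum_(v <- V | S v) v].

Definition conv_hull (T : set vec) : set vec :=
  [set x | exists (k : nat) (w : 'I_k -> R) (p : 'I_k -> vec),
      (forall i, 0 <= w i) /\ \sum_(i < k) w i = 1 /\
      (forall i, T (p i)) /\ x = \sum_(i < k) w i *: p i].

Definition extreme_point (C : set vec) (x : vec) : Prop :=
  C x /\ ~ exists x0 x1 (l : R), C x0 /\ C x1 /\ x0 != x1 /\
            0 < l < 1 /\ x = (1 - l) *: x0 + l *: x1.

End Defs.

(* Main.v *)
(* Let f be a generic linear functional on T whose maximum is attained at t, and
   orient V so that f is positive on it.  If t - sum(W) were outside C = cl conv T
   for some W in V, separate it from C by a generic g and rotate f into g.  When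
   the rotating functional vanishes on a vector v of V, every maximizer on T has a
   neighbour at +v or -v which is again a maximizer; genericity and non-parallelism
   make these moments distinct, so each vector of W with g(v) < 0 contributes its
   full length to the boundary of C between the f-top and the g-top.  Hence the
   maximum of g on T is at least g(t - sum(W)), a contradiction.
   An extreme point x of C is cut off from the rest of C by arbitrarily small
   slices, hence is a limit of such points t; as V has finitely many subset sums,
   one translate of P(V) can be carried to x. *)
Require Import Defs.
From HB Require Import structures.
From mathcomp Require Import all_boot all_order all_algebra.
From mathcomp Require Import all_classical all_reals all_analysis.
From mathcomp Require Import ring lra.
Set Implicit Arguments. Unset Strict Implicit. Unset Printing Implicit Defensive.
Import Order.TTheory GRing.Theory Num.Theory.
Import numFieldNormedType.Exports.
Local Open Scope classical_set_scope.
Local Open Scope ring_scope.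

(** * Inner product of row vectors, compared with the sup norm *)

Section Dot.
Context {R : realType} {n : nat}.
Implicit Types a b y z : 'rV[R]_n.

Definition dot a y : R := \sum_i a 0 i * y 0 i.

Lemma dotC a y : dot a y = dot y a.
Proof. by apply: eq_bigr => i _; rewrite mulrC. Qed.

Lemma dotDr a y z : dot a (y + z) = dot a y + dot a z.
Proof. by rewrite -big_split; apply: eq_bigr => i _; rewrite mxE mulrDr. Qed.

Lemma dotZr a c y : dot a (c *: y) = c * dot a y.
Proof. by rewrite mulr_sumr; apply: eq_bigr => i _; rewrite mxE mulrCA. Qed.

Lemma dotNr a y : dot a (- y) = - dot a y.
Proof. by rewrite -scaleN1r dotZr mulN1r. Qed.

Lemma dotBr a y z : dot a (y - z) = dot a y - dot a z.
Proof. by rewrite dotDr dotNr. Qed.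

Lemma dotDl a b y : dot (a + b) y = dot a y + dot b y.
Proof. by rewrite dotC dotDr !(dotC y). Qed.

Lemma dotZl a c y : dot (c *: a) y = c * dot a y.
Proof. by rewrite dotC dotZr dotC. Qed.

Lemma dotBl a b y : dot (a - b) y = dot a y - dot b y.
Proof. by rewrite dotC dotBr !(dotC y). Qed.

Lemma dot_sumr a (L : seq 'rV[R]_n) :
  dot a (\sum_(v <- L) v) = \sum_(v <- L) dot a v.
Proof.
apply: (big_morph (dot a) (dotDr a)).
by rewrite -(scale0r 0) dotZr mul0r.
Qed.

Lemma coord_le_norm y i : `|y 0 i| <= `|y|.
Proof.
rewrite [leRHS]/Num.norm /= mx_normrE; apply/bigmax_geP; right.
by exists (0, i).
Qed.

Lemma norm_le_coord y r : 0 <= r -> (forall i, `|y 0 i| <= r) -> `|y| <= r.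
Proof.
move=> r0 yr; rewrite [leLHS]/Num.norm /= mx_normrE; apply/bigmax_leP.
by split => // -[i j] _ /=; rewrite ord1.
Qed.

Lemma norm_coord_attained y : 0 < `|y| -> exists i, `|y 0 i| = `|y|.
Proof.
move=> y0; have [[i j]] := @mx_norm_neq0 R 1 n y (lt0r_neq0 y0).
by rewrite /= ord1 => e; exists j; rewrite [RHS]/Num.norm /= e.
Qed.

Lemma dot_norm a y : `|dot a y| <= n%:R * `|a| * `|y|.
Proof.
apply: le_trans (ler_norm_sum _ _ _) _.
apply: (@le_trans _ _ (\sum_(i < n) `|a| * `|y|)).
  by apply: ler_sum => i _; rewrite normrM ler_pM ?coord_le_norm.
by rewrite sumr_const card_ord -[leLHS]mulr_natl mulrA.
Qed.

Lemma dot_ge0 y : 0 <= dot y y.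
Proof. by apply: sumr_ge0 => i _; rewrite -expr2 sqr_ge0. Qed.

Lemma sqr_coord_le_dot y i : y 0 i ^+ 2 <= dot y y.
Proof.
rewrite /dot (bigD1 i) //= -expr2 lerDl.
by apply: sumr_ge0 => j _; rewrite -expr2 sqr_ge0.
Qed.

Lemma dot_gt0 y : y != 0 -> 0 < dot y y.
Proof.
move=> y0; rewrite lt_def dot_ge0 andbT; apply: contra_neq y0 => yy0.
apply/rowP => i; rewrite mxE; apply/eqP; rewrite -sqrf_eq0 eq_le sqr_ge0 andbT.
by rewrite -yy0 sqr_coord_le_dot.
Qed.

Lemma norm_le_dot y : `|y| <= 1 + dot y y.
Proof.
apply: norm_le_coord => [|i]; first by rewrite addr_ge0 ?dot_ge0.
have := sqr_coord_le_dot y i; rewrite -real_normK ?num_real//.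
by have := normr_ge0 (y 0 i); nra.
Qed.

Lemma dot_comp_continuous (S : topologicalType) (p q : S -> 'rV[R]_n) :
  continuous p -> continuous q -> continuous (fun s => dot (p s) (q s)).
Proof.
move=> cp cq.
apply: (@continuous_big R _ +%R 0 xpredT _ _ _ (fun i s => p s 0 i * q s 0 i)) => [|i _].
  exact: add_continuous.
have c i' (r : S -> 'rV[R]_n) : continuous r -> continuous (fun s => r s 0 i').
  move=> cr s; apply: (@continuous_comp _ _ _ r (fun y : 'rV_n => y 0 i')).
    exact: cr.
  exact: coord_continuous.
by move=> s; apply: continuousM; exact: c.
Qed.

Lemma dot_continuous a : continuous (dot a).
Proof.
apply: (@dot_comp_continuous _ (fun=> a) id); first exact: cst_continuous.
by move=> y; exact: cvg_id.
Qed.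

End Dot.

(** * Continuity of distances and of the parametrization of segments *)

Section NormedContinuity.
Context {R : realType} {V : normedModType R}.

Lemma subr_cst_continuous (c : V) : continuous (fun y : V => y - c).
Proof. by move=> y; apply: cvgB; [exact: cvg_id|exact: cvg_cst]. Qed.

Lemma dist_continuous (c : V) : continuous (fun y : V => `|y - c|).
Proof. by move=> y; apply: cvg_norm; exact: subr_cst_continuous. Qed.

Lemma segment_continuous : continuous
  (fun z : R * V * V => (1 - z.1.1) *: z.1.2 + z.1.1 *: z.2).
Proof.
move=> z.
have c1 : {for z, continuous (fun z : R * V * V => z.1.1)}.
  by apply: (@continuous_comp _ _ _ fst fst); exact: cvg_fst.
have c2 : {for z, continuous (fun z : R * V * V => z.1.2)}.
  by apply: (@continuous_comp _ _ _ fst snd); [exact: cvg_fst|exact: cvg_snd].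
have c3 : {for z, continuous (fun z : R * V * V => z.2)} by exact: cvg_snd.
apply: cvgD; apply: cvgZ => //.
by apply: cvgB => //; exact: cvg_cst.
Qed.

End NormedContinuity.

(** * Separation of a point from a closed convex set *)

Section Separation.
Context {R : realType} {n : nat}.
Local Notation vec := 'rV[R]_n.
Implicit Types (A B C : set vec) (x y : vec).

Definition convex_subset A : Prop := forall a b (l : R),
  A a -> A b -> 0 <= l <= 1 -> A ((1 - l) *: a + l *: b).

(** Points of [A] outside the ball of radius [M] have values below [phi y0], so it is enough to
    maximize over the part of [A] in that ball, which is compact. *)
Lemma closed_max A (phi : vec -> R) y0 M :
  closed A -> continuous phi -> A y0 ->
  (forall y, A y -> phi y0 <= phi y -> `|y| <= M) ->
  exists2 m, A m & forall y, A y -> phi y <= phi m.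
Proof.
move=> Acl phic Ay0 AM.
pose D := A `&` [set y | `|y| <= M].
have Dc : compact D.
  apply: bounded_closed_compact.
    exists M; split; first exact: num_real.
    by move=> r Mr y [_ /= /le_trans]; apply; exact: ltW.
  apply: closedI => //.
  apply: (@preimage_closed _ _ (fun y : vec => `|y|) [set r | r <= M]).
    by move=> y _; exact: norm_continuous.
  exact: closed_le.
have Dy0 : D y0 by split => //; exact: AM.
have [m mD mmax] : exists2 m, m \in D & forall t, t \in D -> phi t <= phi m.
  by apply: EVT_max_rV => //; [exists y0|exact: continuous_subspaceT].
have [Am mM] := set_mem mD.
exists m => // y Ay.
have [lt|ge] := ltP (phi y) (phi y0).
  by apply: le_trans (ltW lt) _; apply: mmax; exact/mem_set.
by apply: mmax; apply/mem_set; split => //; exact: AM.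
Qed.

Lemma nonpos_of_le_eps (u K : R) : 0 <= K ->
  (forall l, 0 < l <= 1 -> u <= l * K) -> u <= 0.
Proof.
move=> K0 uK; rewrite leNgt; apply/negP => u0.
have d0 : 0 < u + K + 1 by lra.
(* With this [l] the bound would give [u + K + 1 <= K]. *)
have := uK (u / (u + K + 1)); rewrite divr_gt0//= ler_pdivrMr// mul1r.
have -> : u <= u + K + 1 by lra.
move=> /(_ isT); rewrite mulrAC ler_pdivlMr//; nra.
Qed.

(** The normal is [y0 - m], where [m] is the point of [C] nearest to [y0] in Euclidean distance. *)
Lemma separation C c0 y0 : closed C -> convex_subset C -> C c0 -> ~ C y0 ->
  exists g M, (forall y, C y -> dot g y <= M) /\ M < dot g y0.
Proof.
move=> Ccl Ccvx Cc0 Cy0.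
have [||m Cm mmax] := @closed_max C (fun y => - dot (y - y0) (y - y0)) c0
    (`|y0| + 1 + dot (c0 - y0) (c0 - y0)) Ccl _ Cc0.
- have cB : continuous (fun y : vec => y - y0).
    exact: subr_cst_continuous.
  move=> y; apply: (@continuous_comp _ _ _ (fun y => dot (y - y0) (y - y0)) -%R).
    exact: (dot_comp_continuous cB cB).
  exact: opp_continuous.
- move=> y Cy; rewrite lerN2 => le.
  have := norm_le_dot (y - y0); have := ler_normD (y - y0) y0.
  rewrite subrK; lra.
exists (y0 - m), (dot (y0 - m) m); split => [y Cy|].
  rewrite -subr_le0 -dotBr; apply: (@nonpos_of_le_eps _ (dot (y - m) (y - m))).
    exact: dot_ge0.
  (* Moving from [m] towards [y] by a fraction [l] cannot bring the point closer to [y0]; after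
     division by [l] the error term vanishes with [l]. *)
  move=> l l01.
  have l01' : 0 <= l <= 1 by lra.
  have := mmax _ (Ccvx _ _ _ Cm Cy l01'); rewrite lerN2.
  have -> : (1 - l) *: m + l *: y - y0 = l *: (y - m) - (y0 - m).
    rewrite scalerBl scale1r scalerBr opprB !addrA; congr (_ - _).
    by rewrite addrAC -addrA addrC.
  rewrite -(opprB y0 m) dotNr dotC dotNr opprK.
  move: (y0 - m) (y - m) => q p.
  rewrite !(dotBr, dotZr) ![dot (_ - _) _]dotC !(dotBr, dotZr) (dotC p q).
  by have := dot_ge0 p; nra.
rewrite -subr_gt0 -dotBr; apply: dot_gt0; rewrite subr_eq0.
by apply: contra_notN Cy0 => /eqP ->.
Qed.
End Separation.

(** * Convex hulls and their closures *)

Section ConvexHull.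
Context {R : realType} {n : nat}.
Local Notation vec := 'rV[R]_n.
Implicit Types (A T : set vec) (x y : vec).

Lemma closure_normP A x :
  closure A x <-> forall e : R, 0 < e -> exists2 a, A a & `|x - a| < e.
Proof.
split=> [Ax e e0|Ax B /nbhs_ballP[e e0 eB]].
  have [a [Aa]] := Ax _ (nbhsx_ballx x e e0).
  by rewrite -ball_normE /= => xa; exists a.
have [a Aa xa] := Ax e e0; exists a; split => //; apply: eB.
by rewrite -ball_normE.
Qed.

Lemma conv_hull_convex T : convex_subset (conv_hull T).
Proof.
move=> _ _ l [k [w [p [w0 [w1 [Tp ->]]]]]] [k' [w' [p' [w'0 [w'1 [Tp' ->]]]]]].
move=> /andP[l0 l1].
exists (k + k')%N.
exists (fun i => match fintype.split i with
                 | inl j => (1 - l) * w j | inr j => l * w' j end).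
exists (fun i => match fintype.split i with inl j => p j | inr j => p' j end).
have unl j : fintype.split (lshift k' j) = inl j by rewrite (unsplitK (inl j)).
have unr j : fintype.split (rshift k j) = inr j by rewrite (unsplitK (inr j)).
split=> [i|]; first by case: (fintype.split i) => j; rewrite mulr_ge0// subr_ge0.
split; [|split=> [i|]]; last 2 first.
- by case: (fintype.split i).
- rewrite big_split_ord /= !scaler_sumr.
  by congr (_ + _); apply: eq_bigr => i _; rewrite ?unl ?unr scalerA.
rewrite big_split_ord /=.
under eq_bigr do rewrite unl.
under [X in _ + X]eq_bigr do rewrite unr.
by rewrite -!mulr_sumr w1 w'1 !mulr1 subrK.
Qed.

Lemma sub_conv_hull T : T `<=` conv_hull T.
Proof.
move=> t Tt; exists 1%N, (fun=> 1), (fun=> t).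
by rewrite !big_ord1 scale1r.
Qed.

Lemma closure_convex A : convex_subset A -> convex_subset (closure A).
Proof.
move=> Acvx x y l /closure_normP Ax /closure_normP Ay l01.
apply/closure_normP => e e0.
have [a Aa xa] := Ax e e0; have [b Ab yb] := Ay e e0.
exists ((1 - l) *: a + l *: b); first exact: Acvx.
rewrite opprD addrACA -!scalerBr.
apply: le_lt_trans (ler_normD _ _) _; rewrite !normrZ.
rewrite (@ger0_norm _ (1 - l)) ?(@ger0_norm _ l); [|lra..].
have [m [xm ym me]] : exists m, [/\ `|x - a| <= m, `|y - b| <= m & m < e].
  by exists (Num.max `|x - a| `|y - b|); rewrite !le_max !lexx orbT gt_max xa.
apply: le_lt_trans me; nra.
Qed.

Lemma dot_le_conv_hull g T M : (forall t, T t -> dot g t <= M) ->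
  forall y, closure (conv_hull T) y -> dot g y <= M.
Proof.
move=> TM.
have HM y : conv_hull T y -> dot g y <= M.
  move=> [k [w [p [w0 [w1 [Tp ->]]]]]].
  have -> : dot g (\sum_(i < k) w i *: p i) = \sum_(i < k) w i * dot g (p i).
    rewrite (big_morph (dot g) (dotDr g) (_ : _ = 0)).
      by apply: eq_bigr => i _; rewrite dotZr.
    by rewrite -(scale0r 0) dotZr mul0r.
  rewrite -[leRHS]mul1r -w1 mulr_suml; apply: ler_sum => i _.
  by rewrite ler_wpM2l// TM.
have clM : closed [set y | dot g y <= M].
  apply: (@preimage_closed _ _ (dot g) [set r | r <= M]).
    by move=> y _; exact: dot_continuous.
  exact: closed_le.
move=> y Cy; apply: clM; apply: closureS Cy; exact: HM.
Qed.

End ConvexHull.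

(** * Small slices at an extreme point *)

Section Slices.
Context {R : realType} {n : nat}.
Local Notation vec := 'rV[R]_n.
Implicit Types (A B C D : set vec) (x y : vec).

(** For nonempty convex [A] and [B] this is the convex hull of their union; it is empty as soon as
    one of them is. *)
Definition join A B : set vec := [set y | exists (l : R) a b,
  [/\ 0 <= l <= 1, A a, B b & y = (1 - l) *: a + l *: b]].

Lemma join_compact A B : compact A -> compact B -> compact (join A B).
Proof.
move=> cA cB.
have -> : join A B = (fun z : R * vec * vec =>
    (1 - z.1.1) *: z.1.2 + z.1.1 *: z.2) @` ((`[0, 1] `*` A) `*` B).
  apply/seteqP; split => [_ [l [a [b [l01 Aa Bb ->]]]]|_ [[[l a] b] [[/= l01 Aa Bb] <-]]].
    by exists (l, a, b); rewrite //=; split => //; split => //=; rewrite in_itv.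
  by exists l, a, b; split => //; move: l01; rewrite in_itv.
apply: continuous_compact.
  apply: continuous_subspaceT; exact: segment_continuous.
by apply: compact_setX => //; apply: compact_setX => //; exact: segment_compact.
Qed.

Lemma join_convex A B :
  convex_subset A -> convex_subset B -> convex_subset (join A B).
Proof.
move=> cA cB _ _ m [l [a [b [l01 Aa Bb ->]]]] [l' [a' [b' [l'01 Aa' Bb' ->]]]] m01.
(* In the combined point, [q] is the total weight on [B] and [p] the total weight on [A]. *)
pose q := (1 - m) * l + m * l'; pose p := (1 - m) * (1 - l) + m * (1 - l').
have pq : 1 - q = p by rewrite /p /q; ring.
have q01 : 0 <= q <= 1 by rewrite /q; apply/andP; split; nra.
have comb (E : set vec) (u v r : R) e e' : convex_subset E -> 0 <= u -> 0 <= v ->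
    E e -> E e' -> u + v = r -> exists2 e'', E e'' & r *: e'' = u *: e + v *: e'.
  move=> cE u0 v0 Ee Ee' uvr.
  have [r0|r0] := eqVneq r 0.
    exists e => //; have -> : u = 0 by lra.
    have -> : v = 0 by lra.
    by rewrite r0 !scale0r addr0.
  have rp : 0 < r by rewrite lt_def r0 -uvr addr_ge0.
  exists ((1 - v / r) *: e + (v / r) *: e').
    apply: cE => //; rewrite divr_ge0 ?(ltW rp)//= ler_pdivrMr// mul1r; lra.
  rewrite scalerDr !scalerA; congr (_ *: _ + _ *: _); last by field.
  by rewrite -uvr; field; rewrite uvr.
have [a'' Aa'' ea] : exists2 a'', A a'' &
    p *: a'' = ((1 - m) * (1 - l)) *: a + (m * (1 - l')) *: a'.
  by apply: comb => //; nra.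
have [b'' Bb'' eb] : exists2 b'', B b'' &
    q *: b'' = ((1 - m) * l) *: b + (m * l') *: b'.
  by apply: comb => //; nra.
exists q, a'', b''; split => //.
by rewrite pq ea eb !scalerDr !scalerA addrACA.
Qed.

Lemma sub_joinl A B b : B b -> A `<=` join A B.
Proof.
by move=> Bb a Aa; exists 0, a, b; rewrite lexx ler01 subr0 scale1r scale0r addr0.
Qed.

Lemma sub_joinr A B a : A a -> B `<=` join A B.
Proof.
by move=> Aa b Bb; exists 1, a, b; rewrite lexx ler01 subrr scale1r scale0r add0r.
Qed.

(** An extreme point lying on a segment inside [C] must be one of its endpoints. *)
Lemma join_avoids_extreme C x A B : extreme_point C x ->
  A `<=` C -> B `<=` C -> ~ A x -> ~ B x -> ~ join A B x.
Proof.
move=> [Cx xext] AC BC Ax Bx [l [a [b [/andP[l0 l1] Aa Bb xE]]]].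
have [l0'|l0'] := eqVneq l 0.
  by apply: Ax; rewrite xE l0' subr0 scale1r scale0r addr0.
have [l1'|l1'] := eqVneq l 1.
  by apply: Bx; rewrite xE l1' subrr scale1r scale0r add0r.
have [ab|ab] := eqVneq a b.
  by apply: Bx; rewrite xE ab -scalerDl subrK scale1r.
apply: xext; exists a, b, l; split; first exact: AC.
split; first exact: BC.
by split => //; split => //; rewrite !lt_def l0' l0 l1 eq_sym l1'.
Qed.

Definition avoiding C x D : Prop :=
  [/\ compact D, convex_subset D, D `<=` C & ~ D x].

(** The sets are joined one at a time; empty ones are skipped, since joining with them would lose
    everything. *)
Lemma avoiding_bigjoin C x (I : eqType) (s : seq I) (F : I -> set vec) :
  convex_subset C -> extreme_point C x -> (forall i, avoiding C x (F i)) ->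
  exists2 D, avoiding C x D & forall i, i \in s -> F i `<=` D.
Proof.
move=> Ccvx xext FP; elim: s => [|i s [D DP FD]].
  by exists set0 => //; split => //; exact: compact0.
have [[f Ff]|/nonemptyPn F0] := pselect (F i !=set0); last first.
  by exists D => // j; rewrite inE => /predU1P[->|/FD//]; rewrite F0 => ? [].
have [[d Dd]|/nonemptyPn D0] := pselect (D !=set0); last first.
  exists (F i) => // j; rewrite inE => /predU1P[->//|/FD]; rewrite D0 subset0 => ->.
  exact: sub0set.
have [cF vF FC Fx] := FP i; have [cD vD DC Dx] := DP.
exists (join (F i) D); last first.
  move=> j; rewrite inE => /predU1P[->|/FD Fj]; first exact: sub_joinl Dd.
  by apply: subset_trans Fj _; exact: sub_joinr Ff.
split; [exact: join_compact|exact: join_convex| |exact: (join_avoids_extreme xext FC DC)].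
by move=> _ [l [a [b [l01 Aa Bb ->]]]]; apply: Ccvx => //; [exact: FC|exact: DC].
Qed.

Lemma avoiding_separated C x D : avoiding C x D ->
  exists f d, 0 < d /\ forall z, D z -> dot f z <= dot f x - d.
Proof.
move=> [cD vD DC Dx].
have [[z Dz]|/nonemptyPn ->] := pselect (D !=set0); last by exists 0, 1.
have clD : closed D by apply: compact_closed cD; exact: norm_hausdorff.
have [g [M [DM Mx]]] := separation clD vD Dz Dx.
exists g, (dot g x - M); rewrite subr_gt0; split => // y /DM.
by rewrite opprB addrC subrK.
Qed.

(* The sup-norm sphere around [x] is a finite union of convex faces, so its trace
   on [C] lies in a compact convex set that still avoids the extreme point. *)
Lemma extreme_point_slice C x e : closed C -> convex_subset C ->
  extreme_point C x -> 0 < e ->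
  exists f c, 0 < c /\
    forall y, C y -> e <= `|y - x| -> dot f y <= dot f x - c * `|y - x|.
Proof.
move=> Ccl Ccvx xext e0.
(* The facets of the cube of radius [e] around [x]: the index picks the coordinate, and [true]
   stands for the side [- e]. *)
pose F (ib : 'I_n * bool) := C `&` [set y | `|y - x| <= e] `&`
  [set y : vec | y 0 ib.1 = x 0 ib.1 + (-1) ^+ ib.2 * e].
have FP ib : avoiding C x (F ib).
  split.
  - apply: bounded_closed_compact.
      exists (`|x| + e); split; first exact: num_real.
      move=> r /ltW ler y [[_ /= yx] _]; apply: le_trans ler.
      by rewrite -{1}(subrK x y) addrC; apply: le_trans (ler_normD _ _) _; rewrite lerD2l.
    apply: closedI; first apply: closedI => //.
      apply: (@preimage_closed _ _ (fun y : vec => `|y - x|) [set r | r <= e]).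
        by move=> y _; exact: dist_continuous.
      exact: closed_le.
    apply: (@preimage_closed _ _ (fun y : vec => y 0 ib.1)
        [set r | r = x 0 ib.1 + (-1) ^+ ib.2 * e]).
      by move=> y _; exact: coord_continuous.
    exact: closed_eq.
  - move=> a b l [[Ca /= ae] ai] [[Cb /= be] bi] l01; split; first split => /=.
    + exact: Ccvx.
    + have -> : (1 - l) *: a + l *: b - x = (1 - l) *: (a - x) + l *: (b - x).
        rewrite !scalerBr addrACA -opprD; congr (_ - _).
        by rewrite -scalerDl subrK scale1r.
      apply: le_trans (ler_normD _ _) _; rewrite !normrZ.
      rewrite (@ger0_norm _ (1 - l)) ?(@ger0_norm _ l); [|lra..].
      nra.
    + by rewrite /= !mxE; move: ai bi => /= -> ->; ring.
  - by move=> y [[]].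
  - move=> [_ /= /esym/eqP]; rewrite -[eqbRHS]addr0 (inj_eq (addrI _)).
    by rewrite mulf_eq0 signr_eq0 (gt_eqF e0).
have [D DP FD] := avoiding_bigjoin (enum {: 'I_n * bool}) Ccvx xext FP.
have [f [d [d0 fd]]] := avoiding_separated DP.
exists f, (d / e); split; first exact: divr_gt0.
move=> y Cy ley; set N := `|y - x| in ley *.
have N0 : 0 < N by lra.
(* [z] is the point where the segment from [x] to [y] crosses the cube's boundary; the drop [d] of
   [f] at [z] becomes [d / l] at [y]. *)
pose l := e / N; pose z := (1 - l) *: x + l *: y.
have l01 : 0 <= l <= 1 by rewrite divr_ge0 ?(ltW e0) ?(ltW N0)//= ler_pdivrMr// mul1r.
have Cz : C z by apply: Ccvx => //; case: xext.
have zx : z - x = l *: (y - x).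
  by rewrite /z scalerBl scale1r scalerBr addrAC [x - _]addrC addrK addrC.
have nz : `|z - x| = e.
  rewrite zx normrZ ger0_norm; last by case/andP: l01.
  by rewrite -/N /l divfK// gt_eqF.
have [i zi] : exists i, `|(z - x) 0 i| = `|z - x|.
  by apply: norm_coord_attained; rewrite nz.
have Dz : D z.
  apply: (FD (i, (z - x) 0 i < 0)); first by rewrite mem_enum.
  split; first by split => //=; rewrite nz.
  have zxi : (z - x) 0 i = z 0 i - x 0 i by rewrite mxE [X in _ + X]mxE.
  rewrite /= -nz -zi; case: ltP => h; rewrite ?expr1 ?expr0 ?mul1r.
    by rewrite ltr0_norm// mulN1r opprK zxi addrC subrK.
  by rewrite ger0_norm// zxi addrC subrK.
have lfd : l * (dot f y - dot f x) <= - d.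
  by rewrite -dotBr -dotZr -zx dotBr; have := fd _ Dz; lra.
have -> : d / e * N = d / l.
  by rewrite /l invf_div; ring.
have l0 : 0 < l by exact: divr_gt0.
have : dot f y - dot f x <= - d / l by rewrite ler_pdivlMr// mulrC.
lra.
Qed.

End Slices.

(** * Generic perturbation of linear functionals *)

Section Generic.
Context {R : realType} {n : nat}.
Local Notation vec := 'rV[R]_n.

Lemma small_scale (s : seq (R * R)) :
  (forall pq, pq \in s -> 0 < pq.2) ->
  exists2 h : R, 0 < h & forall pq, pq \in s -> h * `|pq.1| < pq.2.
Proof.
elim: s => [_|[p q] s IH sP]; first by exists 1.
have [|h h0 hs] := IH; first by move=> u us; apply: sP; rewrite inE us orbT.
have q0 : 0 < q by apply: (sP (p, q)); rewrite inE eqxx.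
have p0 : 0 < `|p| + 1 by have := normr_ge0 p; lra.
have qp : 0 < q / (`|p| + 1) by exact: divr_gt0.
exists (Num.min h (q / (`|p| + 1))); first by rewrite lt_min h0.
move=> u; rewrite inE => /predU1P[->/=|/hs]; last first.
  by apply: le_lt_trans; rewrite ler_wpM2r// ge_min lexx.
apply: (@le_lt_trans _ _ (q / (`|p| + 1) * `|p|)).
  by rewrite ler_wpM2r// ge_min lexx orbT.
by rewrite mulrAC ltr_pdivrMr// ltr_pM2l// ltrDl.
Qed.

(** If the current [b] kills a nonzero [v], adding a small multiple of [v] itself repairs this,
    because [dot v v] is positive. *)
Lemma generic_vector (L : seq vec) a e : 0 < e ->
  exists2 b : vec, `|b - a| < e & forall v, v \in L -> v != 0 -> dot b v != 0.
Proof.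
move=> e0; elim: L => [|v L [b ba bL]]; first by exists a; rewrite ?subrr ?normr0.
have [/orP vP|] := boolP ((v == 0) || (dot b v != 0)).
  exists b => // u; rewrite inE => /predU1P[->|/bL//].
  by case: vP => [/eqP->|//]; rewrite eqxx.
rewrite negb_or negbK => /andP[v0 /eqP bv].
(* The first constraint keeps the new vector within [e] of [a]; the others keep nonzero values from
   being cancelled. *)
pose s := (`|v|, e - `|b - a|) ::
  [seq (dot v u, `|dot b u|) | u <- [seq u <- L | u != 0]].
have [|h h0 hs] := @small_scale s.
  move=> pq; rewrite inE => /predU1P[->/=|/mapP[u]]; first by rewrite subr_gt0.
  by rewrite mem_filter => /andP[u0 uL] -> /=; rewrite normr_gt0 bL.
exists (b + h *: v).
  have := hs (`|v|, e - `|b - a|); rewrite inE eqxx normr_id => /(_ isT) /= hv.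
  rewrite addrAC; apply: le_lt_trans (ler_normD _ _) _.
  by rewrite normrZ gtr0_norm//; lra.
move=> u; rewrite inE => /predU1P[-> _|uL u0].
  by rewrite dotDl dotZl bv add0r mulf_neq0 ?gt_eqF// dot_gt0.
have /= := hs (dot v u, `|dot b u|); rewrite inE map_f ?orbT; last first.
  by rewrite mem_filter u0.
move=> /(_ isT); rewrite dotDl dotZl => hu; apply/eqP => E.
have E' : dot b u = - (h * dot v u) by lra.
by move: hu; rewrite E' normrN normrM gtr0_norm// ltxx.
Qed.

Lemma generic_functional (L : seq vec) a e : 0 < e ->
  exists2 b : vec, forall y, `|dot b y - dot a y| <= e * `|y|
    & forall v, v \in L -> v != 0 -> dot b v != 0.
Proof.
move=> e0; have n0 : 0 < n%:R + 1 :> R by have := ler0n R n; lra.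
have [b ba bL] := generic_vector L a (divr_gt0 e0 n0).
exists b => // y.
have -> : dot b y - dot a y = dot (b - a) y by rewrite dotBl.
apply: le_trans (dot_norm _ _) _; rewrite ler_wpM2r//.
move: ba; rewrite ltr_pdivlMr// => ba; have := normr_ge0 (b - a); have := ler0n R n; nra.
Qed.

End Generic.

(** * Rotating a functional, and the zonotope below a maximizer *)

Section Zonotope.
Context {R : realType} {n : nat}.
Local Notation vec := 'rV[R]_n.
Implicit Types (T : set vec) (V D L : seq vec) (f g h k x y t u v : vec).

Lemma steep_max T h B c t : closed T -> T t -> 0 < c ->
  (forall y, T y -> dot h y <= B - c * `|y|) ->
  exists2 m, T m & forall y, T y -> dot h y <= dot h m.
Proof.
move=> Tcl Tt c0 hB.
apply: (@closed_max _ _ _ _ t ((B - dot h t) / c)) => //.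
  exact: dot_continuous.
by move=> y Ty hy; rewrite ler_pdivlMr//; have := hB _ Ty; lra.
Qed.

(* As [s] grows, [k] increases along the maximizers of [f + s k] on [T]. At the
   value [sig v] where this functional kills [v], the set of maximizers contains
   two points differing by [v], so there [k] gains at least [- dot k v]. *)
Lemma rotate_past T f k (sig : vec -> R) L :
  Vclosed L T ->
  (forall s, 0 <= s <= 1 ->
     exists2 m, T m & forall y, T y -> dot (f + s *: k) y <= dot (f + s *: k) m) ->
  (forall v, v \in L ->
     [/\ dot k v < 0, dot (f + sig v *: k) v = 0 & 0 <= sig v <= 1]) ->
  forall s a, path <%R s (map sig L) -> T a ->
    (forall y, T y -> dot (f + s *: k) y <= dot (f + s *: k) a) ->
  exists2 b, T b & dot (f + k) (a - \sum_(v <- L) v) <= dot (f + k) b.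
Proof.
move=> + Tmax; elim: L => [|v L IH] LT LP s a.
  by move=> _ Ta _; exists a => //; rewrite big_nil subr0.
move=> /= /andP[ssv svL] Ta amax.
have [kv fv sv01] := LP v (mem_head _ _).
have [m Tm mmax] := Tmax _ sv01.
have [b [Tb bmax kb]] : exists b, [/\ T b,
    forall y, T y -> dot (f + sig v *: k) y <= dot (f + sig v *: k) b
    & dot k a - dot k v <= dot k b].
  (* Comparing the maximizer [a] at [s] with a maximizer [c] at the larger parameter [sig v] gives
     [dot k a <= dot k c]. *)
  have mono c : T c -> dot (f + sig v *: k) m <= dot (f + sig v *: k) c ->
      dot k a <= dot k c.
    move=> Tc mc; have := mmax _ Ta; have := amax _ Tc.
    move: mc; rewrite !(dotDl, dotZl) => ? ? ?; nra.
  (* Either neighbour of [m] is again a maximizer, as the functional kills [v]. Of the two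
     maximizers, [b] is the one with the larger value of [k]. *)
  have [Tmv|Tmv] := LT _ _ Tm (mem_head _ _).
    exists m; split => //; have := mono _ Tmv; rewrite !dotDr fv addr0 lexx.
    by move=> /(_ isT); lra.
  exists (m - v); split => //; rewrite ?dotBr ?fv ?subr0.
    by move=> y Ty; exact: mmax.
  by rewrite lerD2r; exact: mono.
have [||z Tz zP] := IH _ _ _ _ svL Tb bmax.
- by move=> t u Tt uL; apply: LT => //; rewrite inE uL orbT.
- by move=> u uL; apply: LP; rewrite inE uL orbT.
exists z => //; apply: le_trans zP.
(* [f + k] is [f + sig v *: k] plus [1 - sig v] times [k]: the first part does not decrease from [a]
   to [b], and the second gains at least [- dot (f + k) v]. *)
suff : dot (f + k) a - dot (f + k) v <= dot (f + k) b.
  by rewrite big_cons !dotBr dotDr; lra.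
have := bmax _ Ta; move: fv; rewrite !(dotDl, dotZl) => fv ?.
nra.
Qed.

Lemma sub_zonotope_top T D f B c t :
  closed T -> uniq D -> Vclosed D T -> 0 < c ->
  (forall y, T y -> dot f y <= B - c * `|y|) ->
  T t -> (forall y, T y -> dot f y <= dot f t) ->
  (forall v, v \in D -> 0 < dot f v) ->
  (forall u v, u \in D -> v \in D -> u != v ->
     dot f u *: v - dot f v *: u != 0) ->
  closure (conv_hull T) (t - \sum_(v <- D) v).
Proof.
move=> Tcl Du DT c0 fB Tt tmax fD Dpar; apply: contrapT.
set y0 := (t - _) => Cy0.
have TC : T `<=` closure (conv_hull T).
  by apply: subset_trans (@subset_closure _ _); exact: sub_conv_hull.
have [g0 [M [g0M My0]]] := separation (@closed_closure _ _)
  (closure_convex (@conv_hull_convex _ _ T)) (TC _ Tt) Cy0.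
(* Adding [tau *: f] to the separating [g0] gives it linear decay on [T], so that maxima exist;
   [tau] is small enough for [y0] to stay separated. *)
have [|tau tau0 tauP] := @small_scale R [:: (B - dot f y0, dot g0 y0 - M)].
  by move=> pq; rewrite inE => /eqP-> /=; rewrite subr_gt0.
have {tauP} := tauP _ (mem_head _ _); rewrite /= => tauP.
pose M' := M + tau * B.
have gap : 0 < dot (g0 + tau *: f) y0 - M'.
  rewrite dotDl dotZl /M'; have := ler_norm (B - dot f y0); nra.
(* The generic perturbation of size [e] must spoil neither the decay rate [tau * c] nor the gap at
   [y0]. *)
have [|e e0 eP] := @small_scale R
    [:: (1, tau * c); (`|y0|, dot (g0 + tau *: f) y0 - M')].
  by move=> pq; rewrite !inE => /orP[] /eqP-> //=; exact: mulr_gt0.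
have := eP _ (mem_head _ _); rewrite /= normr1 mulr1 => ec.
have : e * `|y0| < dot (g0 + tau *: f) y0 - M'.
  by rewrite -(normr_id y0); apply: (eP (_, _)); rewrite !inE eqxx orbT.
move=> ey {eP}.
(* [g] vanishes on [dot f u *: v - dot f v *: u] exactly when the rotation from [f] to [g] kills [u]
   and [v] at the same moment; genericity excludes this. *)
have [g gP gD] := generic_functional
  [seq dot f u *: v - dot f v *: u | u <- D, v <- D] (g0 + tau *: f) e0.
have gB y : T y -> dot g y <= M' - (tau * c - e) * `|y|.
  move=> Ty; have := gP y; rewrite ler_norml dotDl dotZl => /andP[_ ?].
  by have := g0M _ (TC _ Ty); have := fB _ Ty; rewrite /M'; nra.
have gy0 : M' < dot g y0.
  by have := gP y0; rewrite ler_norml => /andP[? _]; lra.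
(* The zero in [s] of [(1 - s) * dot f v + s * dot g v]; it falls in the interval from 0 to 1 for
   the vectors kept in [D']. *)
pose sig v := dot f v / (dot f v - dot g v).
pose D' := [seq v <- D | dot g v < 0].
pose L := sort (relpre sig <=%R) D'.
have LD' : perm_eq L D' by rewrite /L perm_sort.
have memL v : v \in L = (dot g v < 0) && (v \in D).
  by rewrite (perm_mem LD') mem_filter.
have sigL v : v \in L -> 0 < sig v <= 1.
  rewrite memL => /andP[gv /fD fv].
  by rewrite divr_gt0 ?ler_pdivrMr ?mul1r; lra.
have sigI : {in D' &, injective sig}.
  move=> u v; rewrite !mem_filter => /andP[gu uD] /andP[gv vD] suv.
  apply/eqP/negP => /negP uv.
  have /negP := gD (dot f u *: v - dot f v *: u) (allpairs_f _ uD vD) (Dpar _ _ uD vD uv).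
  apply; apply/eqP.
  have fu := fD _ uD; have fv := fD _ vD.
  move/eqP: suv; rewrite /sig eqr_div; [|lra..] => /eqP.
  rewrite dotBr !dotZr; lra.
have Lpath : path <%R 0 (map sig L).
  rewrite path_sortedE; last exact: lt_trans.
  rewrite -sort_map sort_lt_sorted map_inj_in_uniq ?filter_uniq// andbT.
  by rewrite sort_map; apply/allP => _ /mapP[v /sigL/andP[? _] ->].
have [||||b Tb] := @rotate_past T f (g - f) sig L _ _ _ 0 t Lpath Tt.
- by move=> u v Tu; rewrite memL => /andP[_]; exact: DT.
- move=> s s01; apply: (@steep_max _ _ ((1 - s) * B + s * M')
    ((1 - s) * c + s * (tau * c - e)) t) => //.
    have [->|s0] := eqVneq s 0; first by lra.
    have : 0 < s by rewrite lt_def s0; lra.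
    nra.
  move=> y Ty; have := gB _ Ty; have := fB _ Ty.
  rewrite dotDl dotZl dotBl; nra.
- move=> v vL; have /andP[sv0 sv1] := sigL _ vL.
  move: vL; rewrite memL => /andP[gv /fD fv].
  split; [|rewrite dotDl dotZl|by lra].
    by rewrite dotBl; lra.
  rewrite dotBl /sig; field; lra.
- by move=> y Ty; rewrite scale0r addr0; exact: tmax.
apply/negP; rewrite -ltNge addrC subrK.
have gb : dot g b <= M'.
  by have := gB _ Tb; have := normr_ge0 b; nra.
apply: le_lt_trans gb _; apply: lt_le_trans gy0 _.
(* The vectors left out of [L] have nonnegative [g], so subtracting them as well can only lower the
   value at [y0]. *)
rewrite /y0 !dotBr lerD2l lerN2 !dot_sumr (perm_big _ LD') big_filter.
rewrite [leRHS](bigID (fun v => dot g v < 0)) /= lerDl.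
by apply: sumr_ge0 => v; rewrite -leNgt.
Qed.

End Zonotope.

(** * From nearby maximizers to the extreme point itself *)

Section ExtremePoints.
Context {R : realType} {n : nat}.
Local Notation vec := 'rV[R]_n.
Implicit Types (T : set vec) (V : seq vec) (x y t u v : vec).

(** A generic functional close to the slicing one attains its maximum on [T] inside the slice. That
    maximizer [t] is the top vertex of a translate of the zonotope, with [P] the vectors on which
    the functional is positive. *)
Lemma extreme_point_near_zonotope V T x e :
  (forall v, v \in V -> v != 0) -> uniq V -> no_two_parallel V ->
  closed T -> Vclosed V T -> extreme_point (closure (conv_hull T)) x -> 0 < e ->
  exists t (P : pred vec), `|t - x| < e /\
    forall S : pred vec, closure (conv_hull T)
      (t - \sum_(v <- V | P v) v + \sum_(v <- V | S v) v).
Proof.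
move=> V0 Vu Vpar Tcl VT xext e0; set C := closure _.
have Cx : C x by case: xext.
have [f0 [c [c0 f0P]]] := extreme_point_slice (@closed_closure _ _)
  (closure_convex (@conv_hull_convex _ _ T)) xext e0.
have [f ff0 fV] := generic_functional V f0 (divr_gt0 c0 (ltr0Sn R 1)).
(* Half of the slope [c] pays for replacing [f0] by [f]. *)
have fP y : C y -> e <= `|y - x| -> dot f y <= dot f x - c / 2 * `|y - x|.
  move=> Cy ey; have := f0P _ Cy ey; have := ff0 (y - x).
  by rewrite ler_norml !dotBr => /andP[_ ?]; lra.
pose K := n%:R * `|f| * e.
have K0 : 0 <= K by rewrite !mulr_ge0// ltW.
have fB y : C y -> dot f y <= dot f x + K + c / 2 * (e + `|x|) - c / 2 * `|y|.
  move=> Cy; have yx : `|y| <= `|y - x| + `|x| by rewrite -{1}(subrK x y) ler_normD.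
  have [ey|ey] := leP e `|y - x|; first by have := fP _ Cy ey; nra.
  have : dot f (y - x) <= K.
    apply: le_trans (ler_norm _) _; apply: le_trans (dot_norm _ _) _.
    by rewrite /K ler_wpM2l ?mulr_ge0// ltW.
  by rewrite dotBr; nra.
have TC : T `<=` C.
  by apply: subset_trans (@subset_closure _ _); exact: sub_conv_hull.
have [t1 Tt1] : exists t1, T t1.
  apply: contrapT => T0.
  (* If [T] were empty, every bound would hold vacuously on it and pass to [x], even -1 for the zero
     functional. *)
  have : dot (0 : vec) x <= -1.
    by apply: (@dot_le_conv_hull _ _ _ T) => // t Tt; case: T0; exists t.
  by rewrite -(scale0r 0) dotZl mul0r; lra.
have c2 : 0 < c / 2 by rewrite divr_gt0.
have [t Tt tmax] := steep_max Tcl Tt1 c2 (fun y Ty => fB y (TC _ Ty)).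
exists t, (fun v => 0 < dot f v); split.
  rewrite ltNge; apply/negP => et.
  (* Far from [x], the value at [t] would be below [dot f x], yet the maximum over [T] bounds [f] on
     all of [C]. *)
  have := fP _ (TC _ Tt) et; have := dot_le_conv_hull tmax Cx; nra.
move=> S.
pose sg v := Num.sg (dot f v) *: v.
(* [W] marks where [S] differs from the top vertex; each such change subtracts the vector oriented
   by [sg]. *)
pose W v := (0 < dot f v) (+) S v.
have fv0 v : v \in V -> dot f v != 0 by move=> vV; apply: fV => //; exact: V0.
have fsg v : dot f (sg v) = `|dot f v| by rewrite dotZr -normrEsg.
have sg0 v : v \in V -> Num.sg (dot f v) != 0 by move=> /fv0; rewrite sgr_eq0.
have par u v (p q : R) : u \in V -> v \in V -> p != 0 -> p *: u = q *: v -> u = v.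
  move=> uV vV p0 puv; apply/eqP/negP => /negP uv; apply: (Vpar _ _ uV vV uv).
  by exists (p^-1 * q); left; rewrite -scalerA -puv scalerA mulVf// scale1r.
have -> : t - \sum_(v <- V | 0 < dot f v) v + \sum_(v <- V | S v) v =
    t - \sum_(v <- [seq sg v | v <- V & W v]) v.
  rewrite -addrA; congr (_ + _); rewrite big_map big_filter.
  rewrite (big_mkcond S) (big_mkcond W) (big_mkcond (fun v => 0 < dot f v)) /=.
  rewrite -!sumrN -big_split /=; apply: eq_big_seq => v vV.
  rewrite /W /sg; have [fv|fv|fv] := ltgtP (dot f v) 0.
  - rewrite ltr0_sg// scaleN1r; case: (S v); rewrite /= ?opprK ?oppr0 ?add0r//.
  - rewrite gtr0_sg// scale1r; case: (S v); rewrite /= ?oppr0 ?addNr ?addr0//.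
  - by have := fv0 _ vV; rewrite fv eqxx.
apply: (sub_zonotope_top (f := f) Tcl _ _ c2 (fun y Ty => fB y (TC _ Ty))) => //.
- rewrite map_inj_in_uniq ?filter_uniq// => u v.
  rewrite !mem_filter => /andP[_ uV] /andP[_ vV]; exact: par (sg0 _ uV).
- move=> s w Ts /mapP[v]; rewrite mem_filter => /andP[_ vV] ->; rewrite /sg.
  have [fv|fv|fv] := ltgtP (dot f v) 0.
  + by rewrite ltr0_sg// scaleN1r opprK; case: (VT _ _ Ts vV); [right|left].
  + by rewrite gtr0_sg// scale1r; exact: VT.
  + by have := fv0 _ vV; rewrite fv eqxx.
- by move=> w /mapP[v]; rewrite mem_filter => /andP[_ vV] ->; rewrite fsg normr_gt0 fv0.
- move=> u1 v1 /mapP[u + ->] /mapP[v + ->].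
  rewrite !mem_filter => /andP[_ uV] /andP[_ vV]; apply: contra_neq => /eqP.
  rewrite subr_eq0 !fsg !scalerA => /eqP /par -> //.
  by rewrite mulf_neq0 ?sg0 ?normr_eq0 ?fv0.
Qed.

Fixpoint all_sums V : seq vec :=
  if V is v :: V' then all_sums V' ++ [seq v + p | p <- all_sums V'] else [:: 0].

Lemma mem_all_sums V (S : pred vec) : \sum_(v <- V | S v) v \in all_sums V.
Proof.
elim: V => [|v V IH]; first by rewrite big_nil inE.
rewrite big_cons /= mem_cat; case: (S v); last by rewrite IH.
by apply/orP; right; apply: map_f.
Qed.

(** Each [x + q] outside the closed [C] has a positive distance to it, and finitely many such
    distances have a positive minimum. *)
Lemma closed_finite_translates (C : set vec) x (s : seq vec) : closed C ->
  exists2 e : R, 0 < e &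
    forall q t, q \in s -> `|t - x| < e -> C (t + q) -> C (x + q).
Proof.
move=> Ccl; elim: s => [|q s [e e0 es]]; first by exists 1.
have [d d0 dP] : exists2 d : R, 0 < d &
    forall t, `|t - x| < d -> C (t + q) -> C (x + q).
  have [Cq|Cq] := pselect (C (x + q)); first by exists 1.
  apply: contrapT => H; apply: Cq; apply: Ccl; apply/closure_normP => d d0.
  apply: contrapT => H'; apply: H; exists d => // t td Ct; case: H'.
  by exists (t + q) => //; rewrite opprD addrACA subrr addr0 distrC.
exists (Num.min e d); first by rewrite lt_min e0.
move=> u t; rewrite inE lt_min => /predU1P[->|us] /andP[te td]; first exact: dP.
exact: es.
Qed.

End ExtremePoints.

Theorem theorem1p3 (R : realType) (n : nat) (V : seq 'rV[R]_n)
  (T : set 'rV[R]_n) (x : 'rV[R]_n) :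
  (2 <= n)%N -> uniq V -> no_two_parallel V ->
  closed T -> Vclosed V T ->
  extreme_point (closure (conv_hull T)) x ->
  exists t : 'rV[R]_n,
    (exists2 p, subset_sums V p & x = t + p) /\
    (forall p, subset_sums V p -> closure (conv_hull T) (t + p)).
Proof.
move=> _ Vu Vpar Tcl VT xext.
(* A zero vector changes no subset sum, but no functional is nonzero on it. *)
pose V0 := [seq v <- V | v != 0].
have sumV0 (S : pred 'rV[R]_n) : \sum_(v <- V | S v) v = \sum_(v <- V0 | S v) v.
  rewrite big_filter_cond /= big_mkcond [RHS]big_mkcond; apply: eq_bigr => v _.
  by have [->|] := eqVneq v 0 => //=; case: ifP.
have V0V v : v \in V0 -> v \in V by rewrite mem_filter => /andP[].
(* Relative to the top vertex, the points of a translate of the zonotope are differences of two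
   subset sums, a finite list independent of [e]. *)
have [e e0 eP] := @closed_finite_translates R n _ x
  [seq p - q | p <- all_sums V0, q <- all_sums V0] (@closed_closure _ (conv_hull T)).
have [||||t [P [tx tP]]] := @extreme_point_near_zonotope R n V0 T x e _ _ _ Tcl _ xext e0.
- by move=> v; rewrite mem_filter => /andP[].
- exact: filter_uniq.
- by move=> u v /V0V uV /V0V vV; exact: Vpar.
- by move=> s v Ts /V0V; exact: VT.
exists (x - \sum_(v <- V | P v) v); split.
  by exists (\sum_(v <- V | P v) v); [exists P|rewrite subrK].
move=> _ [S ->]; rewrite !sumV0 -addrA; apply: (eP _ t) => //.
  by rewrite addrC; apply: allpairs_f; exact: mem_all_sums.
by rewrite addrA; exact: tP.
Qed.
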